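(* Let $\alpha>0$ and let $b(\cdot,\cdot)$ be a symmetric, continuous and coercive bilinear form on $L^2(\Omega)$. With the linear matrix-valued map $\mathbf S$ and the data matrix $\mathbf V$ of the context, the minimization problem $$\kappa_r=\operatorname*{arg\,min}_{\kappa\in L^2(\Omega)}\ \|\mathbf V-\mathbf S(\kappa)\|_F^2+\alpha\, b(\kappa,\kappa)$$ is equivalent to the following variational formulation: find $\kappa_r\in L^2(\Omega)$ such that $$a(\kappa_r,\eta)=l(\eta)\qquad\text{for all }\eta\in L^2(\Omega),$$ where the bilinear form $a$ and the linear form $l$ are $$a(\kappa,\eta)=\mathrm{tr}\big(\mathbf S(\kappa)^{\top}\mathbf S(\eta)\big)+\alpha\, b(\kappa,\eta),\qquad l(\eta)=\mathrm{tr}\big(\mathbf V^{\top}\mathbf S(\eta)\big).$$ Moreover, the variational problem admits a unique solution.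
   Context: $\Omega\subset\mathbb R^d$, $d\ge 2$, is a bounded open connected domain with smooth boundary $\partial\Omega$ and outer normal $\nu$. $L^2_\diamond(\partial\Omega)$ is the subspace of $L^2(\partial\Omega)$ of functions with zero integral over $\partial\Omega$; $H^1_\diamond(\Omega)$ is the subspace of $H^1(\Omega)$ of functions with zero integral over $\partial\Omega$; $L^\infty_+(\Omega)$ is the set of functions in $L^\infty(\Omega)$ with positive essential infimum. For $\sigma\in L^\infty_+(\Omega)$ and $g\in L^2_\diamond(\partial\Omega)$, $u_g^\sigma\in H^1_\diamond(\Omega)$ is the unique weak solution of $\nabla\cdot(\sigma\nabla u)=0$ in $\Omega$, $\sigma\partial_\nu u=g$ on $\partial\Omega$, and $\Lambda(\sigma):g\mapsto u_g^\sigma|_{\partial\Omega}$ is the Neumann-to-Dirichlet operator on $L^2_\diamond(\partial\Omega)$. Finitely many inputs $g_1,\dots,g_m\in L^2_\diamond(\partial\Omega)$ are given, $u^0_{g_i}$ denotes the solution for the background conductivity $\sigma\equiv1$ with Neumann datum $g_i$, and $\sigma\in L^\infty_+(\Omega)$ is the unknown conductivity. Set $$\mathbf S(\kappa)=\Big(\int_\Omega\kappa\,\nabla u^0_{g_i}\cdot\nabla u^0_{g_j}\,\mathrm dx\Big)_{i,j=1}^m,\qquad \mathbf V=\Big(\int_{\partial\Omega}g_i\,(\Lambda(1)-\Lambda(\sigma))g_j\,\mathrm ds\Big)_{i,j=1}^m .$$ $\|\mathbf A\|_F^2=\mathrm{tr}(\mathbf A^\top\mathbf A)$ is the Frobenius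 norm. Continuity and coercivity of $b$ are with respect to the $L^2(\Omega)$ norm.
   Formalization: It is assumed that the integrals defining S(κ) exist for every κ in L²(Ω); for d ≥ 3 and inputs g_i merely in L² of the boundary they can diverge, so that S is not defined on all of L²(Ω). *)

(* Defs.v *)
From HB Require Import structures.
From mathcomp Require Import all_boot all_order all_algebra.
From mathcomp Require Import sesquilinear.
From mathcomp Require Import all_classical all_reals all_analysis ess_sup_inf.

Set Implicit Arguments.
Unset Strict Implicit.
Unset Printing Implicit Defensive.
Import Order.TTheory GRing.Theory Num.Theory.
Import numFieldNormedType.Exports.
Local Open Scope classical_set_scope.
Local Open Scope ring_scope.

Section cover_outer.
Context (R : realType) (T I : Type).
Variables (G : set I) (S : I -> set T) (c : I -> \bar R).
Local Open Scope ereal_scope.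

(* [None] stands for the empty set with cost 0, so that covers are at most
   countable families of sets [S i] with [G i]. *)
Let oS (o : option I) : set T := oapp S set0 o.
Let oc (o : option I) : \bar R := oapp c 0 o.
Let oG : set (option I) := [set o | forall i, o = Some i -> G i].

Definition cover_outer (A : set T) : \bar R :=
  ereal_inf [set \sum_(k <oo) oc (F k) | F in
    [set F : nat -> option I |
      (forall k, oG (F k)) /\ A `<=` \bigcup_k oS (F k)]].

Hypothesis c0 : forall i, G i -> 0 <= c i.

Let oc0 o : oG o -> 0 <= oc o.
Proof. by case: o => [i|]//= Gi; apply: c0; exact: Gi. Qed.

Lemma cover_outer_ge0 A : 0 <= cover_outer A.
Proof.
apply: le_ereal_inf_tmp => x [F [GF _] <-{x}].
by apply: nneseries_ge0 => n _ _; exact/oc0.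
Qed.

Lemma cover_outer0 : cover_outer set0 = 0.
Proof.
apply/eqP; rewrite eq_le cover_outer_ge0 andbT.
apply: ereal_inf_lbound; exists (fun=> None); first by split.
by rewrite eseries0.
Qed.

Lemma le_cover_outer : {homo cover_outer : A B / A `<=` B >-> A <= B}.
Proof.
move=> A B AB; apply/ereal_inf_le_tmp => x [F [GF BF]] <-{x}.
by exists F => //; split => //; exact: subset_trans BF.
Qed.

Lemma cover_outer_sigma_subadditive : sigma_subadditive cover_outer.
Proof.
move=> A; have [[i ioo]|] := pselect (exists i, cover_outer (A i) = +oo).
  rewrite (eseries_pinfty _ _ ioo) ?leey// => n _.
  by rewrite -ltNye (lt_le_trans _ (cover_outer_ge0 _)).
rewrite -forallNE => Aoo.
suff add2e (e : {posnum R}) : cover_outer (\bigcup_n A n) <=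
    \sum_(i <oo) cover_outer (A i) + e%:num%:E.
  by apply/lee_addgt0Pr => _/posnumP[].
rewrite (le_trans _ (epsilon_trick _ _ _))//; last first.
  by move=> n; exact: cover_outer_ge0.
pose P n (B : nat -> option I) :=
  ((forall k, oG (B k)) /\ A n `<=` \bigcup_k oS (B k)) /\
  \sum_(k <oo) oc (B k) <= cover_outer (A n) + (e%:num / (2 ^ n.+1)%:R)%:E.
have [H PH] : {H : nat -> nat -> option I & forall n, P n (H n)}.
  apply: (@choice _ _ P) => n; rewrite /P /cover_outer.
  set Q := (X in ereal_inf X); move infQ : (ereal_inf Q) => iQ.
  case: iQ infQ => [r Qr|Qoo|Qoo].
  - have en1 : (0 < e%:num / (2 ^ n.+1)%:R)%R by [].
    have /(lb_ereal_inf_adherent en1) : ereal_inf Q \is a fin_num by rewrite Qr.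
    move=> [x [B [mB AnB] muBx] xQ].
    by exists B; split => //; rewrite muBx -Qr; exact/ltW.
  - by have := Aoo n; rewrite /cover_outer Qoo.
  - suff : lbound Q 0 by move/le_ereal_inf_tmp; rewrite Qoo.
    by move=> /= _ [B [mB AnB] <-]; apply: nneseries_ge0 => k _ _; exact: oc0.
have H_ge0 x : 0 <= (oc \o uncurry H) x.
  by apply: oc0; case: x => n k; exact: (PH n).1.1.
apply: (@le_trans _ _ (\esum_(i in setT) (oc \o uncurry H) i)).
  apply: ereal_inf_lbound => /=.
  have /card_esym/ppcard_eqP[f] := card_nat2.
  exists (uncurry H \o f).
    split => [i|]; first by rewrite /=; case: (f i) => a b; exact: (PH a).1.1.
    apply: (@subset_trans _ (\bigcup_n \bigcup_k oS (H n k))) => [t [i _]|].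
      by move=> /((PH i).1.2) -[j _ ?]; exists i => //; exists j.
    move=> t [i _ [j _ Bijt]]; exists (f^-1%FUN (i, j)) => //=.
    by rewrite invK ?inE.
  rewrite -(esum_pred_image (oc \o uncurry H) _ xpredT) ?[fun=> _]set_true//.
  by rewrite image_eq.
rewrite (_ : esum _ _ = \sum_(i <oo) \sum_(j <oo ) oc (H i j)); last first.
  pose J : nat -> set (nat * nat) := fun i => [set (i, j) | j in setT].
  rewrite (_ : setT = \bigcup_k J k); last first.
    by rewrite predeqE => -[a b]; split => // _; exists a => //; exists b.
  rewrite esum_bigcupT /=; last 2 first.
    - apply/trivIsetP => i j _ _ ij.
      rewrite predeqE => -[n m] /=; split => //= -[] [_] _ [<-{n} _].
      by move=> [m' _] [] /esym/eqP; rewrite (negbTE ij).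
    - by move=> x; exact: H_ge0.
  rewrite -(image_id [set: nat]) -fun_true esum_pred_image//; last first.
    by move=> n _; apply: esum_ge0 => x _; exact: H_ge0.
  apply: eq_eseriesr => /= j _.
  rewrite -(esum_pred_image (oc \o uncurry H) (pair j) predT)//=; last first.
    by move=> ? ? _ _; exact: (@can_inj _ _ _ snd).
    by move=> n _; exact: (H_ge0 (j, n)).
  by congr esum; rewrite predeqE => -[a b]; split; move=> [i _ <-]; exists i.
apply: lee_lim.
- apply: is_cvg_nneseries => n *.
  by apply: nneseries_ge0 => m *; exact: (H_ge0 (n, m)).
- apply: is_cvg_nneseries => n *; apply: adde_ge0 => //.
  exact: cover_outer_ge0.
- by near=> n; apply: lee_sum => i _; exact: (PH i).2.
Unshelve. all: by end_near. Qed.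

End cover_outer.
Arguments cover_outer {R T I} G S c A.
Arguments cover_outer_ge0 {R T I G} S {c}.
Arguments cover_outer0 {R T I G} S {c}.
Arguments le_cover_outer {R T I} G S c.
Arguments cover_outer_sigma_subadditive {R T I G} S {c}.

Section lebesgue_outer.
Context (R : realType) (d : nat).

Definition box (p : 'rV[R]_d * 'rV[R]_d) : set 'rV[R]_d :=
  [set x | forall i, p.1 ord0 i <= x ord0 i <= p.2 ord0 i].

Definition box_volume (p : 'rV[R]_d * 'rV[R]_d) : \bar R :=
  (\prod_i (p.2 ord0 i - p.1 ord0 i))%:E.

Definition proper_box : set ('rV[R]_d * 'rV[R]_d) :=
  [set p : 'rV[R]_d * 'rV[R]_d | forall i, p.1 ord0 i <= p.2 ord0 i].

Definition lebesgue_outer : set 'rV[R]_d -> \bar R :=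
  cover_outer proper_box box box_volume.

Let box_volume_ge0 p : proper_box p -> (0 <= box_volume p)%E.
Proof. by move=> pp; rewrite lee_fin prodr_ge0// => i _; rewrite subr_ge0. Qed.

HB.instance Definition _ := isOuterMeasure.Build R _ lebesgue_outer
  (cover_outer0 box box_volume_ge0) (cover_outer_ge0 box box_volume_ge0)
  (le_cover_outer proper_box box box_volume)
  (cover_outer_sigma_subadditive box box_volume_ge0).

End lebesgue_outer.

Section hausdorff_outer.
Context (R : realType) (d s : nat).

Fixpoint unit_ball_volume (n : nat) : R :=
  match n with
  | 0 => 1
  | 1 => 2
  | k.+2 => 2 * pi / k.+2%:R * unit_ball_volume k
  end.

(* The norm of ['rV[R]_d] in the library is the maximum norm. *)
Definition euclidean_dist (x y : 'rV[R]_d) : R :=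
  Num.sqrt (\sum_i (x ord0 i - y ord0 i) ^+ 2).

Definition diameter (A : set 'rV[R]_d) : \bar R :=
  ereal_sup [set (euclidean_dist p.1 p.2)%:E | p in A `*` A].

Definition hausdorff_gauge (A : set 'rV[R]_d) : \bar R :=
  (unit_ball_volume s * (fine (diameter A) / 2) ^+ s)%:E.

Definition hausdorff_premeasure (delta : R) : set 'rV[R]_d -> \bar R :=
  cover_outer [set A | A !=set0 /\ (diameter A <= delta%:E)%E] id
    hausdorff_gauge.

(* Normalized so that it is the s-dimensional area on smooth surfaces. *)
Definition hausdorff_outer (A : set 'rV[R]_d) : \bar R :=
  ereal_sup [set hausdorff_premeasure delta A | delta in [set e : R | 0 < e]].

Lemma unit_ball_volume_ge0 n : 0 <= unit_ball_volume n.
Proof.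
have [m] := ubnP n; elim: m n => // m IH [|[|n]]//= /ltnW nm.
by rewrite mulr_ge0// ?IH// divr_ge0// mulr_ge0// pi_ge0.
Qed.

Let gauge_ge0 delta (A : set 'rV[R]_d) :
  A !=set0 /\ (diameter A <= delta%:E)%E -> (0 <= hausdorff_gauge A)%E.
Proof.
move=> [[a Aa] _]; rewrite lee_fin mulr_ge0 ?unit_ball_volume_ge0//.
rewrite exprn_ge0// divr_ge0// fine_ge0//.
apply: le_trans (_ : (euclidean_dist a a)%:E <= _)%E.
  by rewrite lee_fin sqrtr_ge0.
by apply: ereal_sup_ubound; exists (a, a).
Qed.

Let premeasure_ge0 delta A : (0 <= hausdorff_premeasure delta A)%E.
Proof. by apply: cover_outer_ge0 => B; exact: gauge_ge0. Qed.

Let le_hausdorff delta A : 0 < delta ->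
  (hausdorff_premeasure delta A <= hausdorff_outer A)%E.
Proof. by move=> d0; apply: ereal_sup_ubound; exists delta. Qed.

Lemma hausdorff_outer_ge0 A : (0 <= hausdorff_outer A)%E.
Proof. exact: le_trans (premeasure_ge0 1 A) (le_hausdorff _ _). Qed.

Lemma hausdorff_outer0 : hausdorff_outer set0 = 0%E.
Proof.
apply/eqP; rewrite eq_le hausdorff_outer_ge0 andbT.
apply: ge_ereal_sup => _ [delta d0 <-].
by rewrite /hausdorff_premeasure cover_outer0// => B; exact: gauge_ge0.
Qed.

Lemma le_hausdorff_outer :
  {homo hausdorff_outer : A B / A `<=` B >-> (A <= B)%E}.
Proof.
move=> A B AB; apply: ge_ereal_sup => _ [delta d0 <-].
by apply: le_trans (le_hausdorff B d0); exact: le_cover_outer.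
Qed.

Lemma hausdorff_outer_sigma_subadditive : sigma_subadditive hausdorff_outer.
Proof.
move=> F; apply: ge_ereal_sup => _ [delta d0 <-].
apply: (@le_trans _ _ (\sum_(i <oo) hausdorff_premeasure delta (F i))%E).
  by apply: cover_outer_sigma_subadditive => B; exact: gauge_ge0.
apply: lee_nneseries => [i _ _|i _]; first exact: premeasure_ge0.
exact: le_hausdorff.
Qed.

HB.instance Definition _ := isOuterMeasure.Build R _ hausdorff_outer
  hausdorff_outer0 hausdorff_outer_ge0 le_hausdorff_outer
  hausdorff_outer_sigma_subadditive.

End hausdorff_outer.

Section restricted_outer.
Context (R : realType) (T : Type).
Variables (mu : {outer_measure set T -> \bar R}) (D : set T).
Local Open Scope ereal_scope.

Definition restricted_outer (A : set T) : \bar R := mu (A `&` D).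

Let restricted0 : restricted_outer set0 = 0.
Proof. by rewrite /restricted_outer set0I outer_measure0. Qed.

Let restricted_ge0 A : 0 <= restricted_outer A.
Proof. exact: outer_measure_ge0. Qed.

Let restricted_le : {homo restricted_outer : A B / A `<=` B >-> A <= B}.
Proof. by move=> A B AB; apply: le_outer_measure; exact: setSI. Qed.

Let restricted_subadditive : sigma_subadditive restricted_outer.
Proof.
move=> F; rewrite /restricted_outer setI_bigcupl.
exact: outer_measure_sigma_subadditive.
Qed.

HB.instance Definition _ := isOuterMeasure.Build R T restricted_outer
  restricted0 restricted_ge0 restricted_le restricted_subadditive.

End restricted_outer.

Section domain_measures.
Context (R : realType) (d : nat).
Implicit Types Omega : set 'rV[R]_d.

Definition boundary Omega : set 'rV[R]_d := closure Omega `\` interior Omega.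

(* A Caratheodory-measurable set for an outer measure restricted to D is a set
   whose trace on D is measurable, when D itself is. Hence functions on the
   following types are functions on R^d of which only the restriction to Omega
   (resp. to the boundary) matters: the complement is a null set. *)
Definition volume_outer Omega : {outer_measure set 'rV[R]_d -> \bar R} :=
  restricted_outer (@lebesgue_outer R d) Omega.

Definition surface_outer Omega : {outer_measure set 'rV[R]_d -> \bar R} :=
  restricted_outer (@hausdorff_outer R d d.-1) (boundary Omega).

Definition volume Omega :
    {measure set (caratheodory_type (volume_outer Omega)) -> \bar R} :=
  (volume_outer Omega : set (caratheodory_type (volume_outer Omega)) -> \bar R).

Definition surface Omega :
    {measure set (caratheodory_type (surface_outer Omega)) -> \bar R} :=
  (surface_outer Omega : set (caratheodory_type (surface_outer Omega)) -> \bar R).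

Definition L2 Omega := LfunType (volume Omega) (lee1n 2).
Definition L2bd Omega := LfunType (surface Omega) (lee1n 2).
HB.instance Definition _ Omega := GRing.Lmodule.on (L2 Omega).
HB.instance Definition _ Omega := GRing.Lmodule.on (L2bd Omega).

End domain_measures.

Section smooth.
Context (R : realType) (d : nat).
Implicit Types (Omega : set 'rV[R]_d) (f : 'rV[R]_d -> R).

Definition partial (i : 'I_d) f : 'rV[R]_d -> R :=
  fun x => 'D_(delta_mx 0 i) (f : 'rV[R]_d -> R^o) x.

Fixpoint class_C (k : nat) f : Prop :=
  if k is k'.+1 then
    [/\ continuous f,
        forall i x, derivable (f : 'rV[R]_d -> R^o) x (delta_mx 0 i) &
        forall i, class_C k' (partial i f)]
  else continuous f.

Definition smooth f : Prop := forall k, class_C k f.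

Definition test_function Omega f : Prop :=
  [/\ smooth f, compact (closure [set x | f x != 0]) &
      closure [set x | f x != 0] `<=` Omega].

(* Near each boundary point, Omega is the sublevel set of a smooth function
   with nonvanishing gradient. *)
Definition smooth_boundary Omega : Prop :=
  forall p, boundary Omega p -> exists rho : 'rV[R]_d -> R,
    [/\ smooth rho, exists i, partial i rho p != 0 &
        \forall x \near p, Omega x <-> rho x < 0].

Definition smooth_domain Omega : Prop :=
  [/\ Omega !=set0, open Omega, connected Omega, bounded_set Omega &
      smooth_boundary Omega].

End smooth.

Section neumann.
Context (R : realType) (d : nat) (Omega : set 'rV[R]_d).
Local Notation vol := (volume Omega).
Local Notation srf := (surface Omega).

(* A pair (u, G); [in_H1] says that u is in H^1 with weak gradient G. *)
Definition jet : Type := (L2 Omega * {ffun 'I_d -> L2 Omega})%type.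

Definition in_H1 (w : jet) : Prop :=
  forall (i : 'I_d) (phi : 'rV[R]_d -> R), test_function Omega phi ->
    \int[vol]_x (w.1 x * partial i phi x) = - \int[vol]_x (w.2 i x * phi x).

(* t is the limit in L^2(boundary) of the boundary values of functions that are
   smooth up to the boundary and converge to w in H^1(Omega). *)
Definition is_trace (w : jet) (t : L2bd Omega) : Prop :=
  exists phi : nat -> 'rV[R]_d -> R,
    [/\ forall n, smooth (phi n),
        Lnorm vol 2%:E (fun x => (phi n x - w.1 x)%:E) @[n --> \oo] --> 0%E,
        forall i, Lnorm vol 2%:E (fun x => (partial i (phi n) x - w.2 i x)%:E)
          @[n --> \oo] --> 0%E &
        Lnorm srf 2%:E (fun x => (phi n x - t x)%:E) @[n --> \oo] --> 0%E].

Definition trace (w : jet) : L2bd Omega := xget 0 [set t | is_trace w t].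

Definition zero_mean (g : L2bd Omega) : Prop := \int[srf]_x g x = 0.

Definition H1_diamond (w : jet) : Prop := in_H1 w /\ zero_mean (trace w).

Definition dot_grad (w v : jet) (x : 'rV[R]_d) : R :=
  \sum_(i < d) w.2 i x * v.2 i x.

Definition weak_solution (sigma : 'rV[R]_d -> R) (g : L2bd Omega) (w : jet) :=
  H1_diamond w /\ forall v, H1_diamond v ->
    \int[vol]_x (sigma x * dot_grad w v x) = \int[srf]_x (g x * trace v x).

(* On a smooth domain the trace exists for every w in H^1, and the solution
   exists by Lax-Milgram for sigma in L^oo_+ and g of zero mean; both are unique
   up to null sets, so the default value 0 of [xget] is never used. *)
Definition solution (sigma : 'rV[R]_d -> R) (g : L2bd Omega) : jet :=
  xget (0, 0) [set w | weak_solution sigma g w].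

Definition Lambda (sigma : 'rV[R]_d -> R) (g : L2bd Omega) : L2bd Omega :=
  trace (solution sigma g).

Definition Linfty_plus (sigma : 'rV[R]_d -> R) : Prop :=
  sigma \in Lfun vol +oo%E /\ (0 < ess_inf vol (EFin \o sigma))%E.

End neumann.

Section regularization.
Context (R : realType) (d : nat) (Omega : set 'rV[R]_d).
Context (m : nat) (g : 'I_m -> L2bd Omega).

Definition sensitivity (i j : 'I_m) : 'rV[R]_d -> R :=
  dot_grad (solution (cst 1) (g i)) (solution (cst 1) (g j)).

(* For gradients that are merely square integrable the entries of S_mx need not be
   defined on all of L^2(Omega). *)
Definition S_well_defined : Prop :=
  forall (kappa : L2 Omega) i j, (volume Omega).-integrable setT
    (fun x => (kappa x * sensitivity i j x)%:E).

Definition S_mx (kappa : L2 Omega) : 'M[R]_m :=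
  \matrix_(i, j) \int[volume Omega]_x (kappa x * sensitivity i j x).

Definition V_mx (sigma : 'rV[R]_d -> R) : 'M[R]_m :=
  \matrix_(i, j) \int[surface Omega]_x
    (g i x * (Lambda (cst 1) (g j) x - Lambda sigma (g j) x)).

Definition frob2 (A : 'M[R]_m) : R := \tr (A^T *m A).

Definition L2norm (kappa : L2 Omega) : R :=
  fine (Lnorm (volume Omega) 2%:E (EFin \o kappa)).

Definition continuous_form (b : L2 Omega -> L2 Omega -> R) : Prop :=
  exists C : R, forall kappa eta,
    `|b kappa eta| <= C * L2norm kappa * L2norm eta.

Definition coercive_form (b : L2 Omega -> L2 Omega -> R) : Prop :=
  exists2 c : R, 0 < c & forall kappa, c * L2norm kappa ^+ 2 <= b kappa kappa.

Definition objective (alpha : R) (b : L2 Omega -> L2 Omega -> R)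
    (sigma : 'rV[R]_d -> R) (kappa : L2 Omega) : R :=
  frob2 (V_mx sigma - S_mx kappa) + alpha * b kappa kappa.

Definition is_minimizer (J : L2 Omega -> R) (kappa : L2 Omega) : Prop :=
  forall eta, J kappa <= J eta.

Definition form_a (alpha : R) (b : L2 Omega -> L2 Omega -> R)
    (kappa eta : L2 Omega) : R :=
  \tr ((S_mx kappa)^T *m S_mx eta) + alpha * b kappa eta.

Definition form_l (sigma : 'rV[R]_d -> R) (eta : L2 Omega) : R :=
  \tr ((V_mx sigma)^T *m S_mx eta).

Definition is_variational_solution (alpha : R)
    (b : L2 Omega -> L2 Omega -> R) (sigma : 'rV[R]_d -> R)
    (kappa : L2 Omega) : Prop :=
  forall eta, form_a alpha b kappa eta = form_l sigma eta.

End regularization.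

(* Main.v *)
Require Import Defs.
From HB Require Import structures.
From mathcomp Require Import all_boot all_order all_algebra.
From mathcomp Require Import sesquilinear.
From mathcomp Require Import all_classical all_reals all_analysis ess_sup_inf.
From mathcomp Require Import measurable_realfun ring lra.
Set Implicit Arguments.
Unset Strict Implicit.
Import Order.TTheory GRing.Theory Num.Theory.
Import numFieldNormedType.Exports.
Local Open Scope classical_set_scope.
Local Open Scope ring_scope.

(** The objective is a constant plus the quadratic energy
    [a(kappa, kappa) - 2 l(kappa)], where [a] is a symmetric bilinear form. On the
    line through [v] in the direction [w] the energy is the parabola
    [energy v + 2 t (a(v, w) - l(w)) + t^2 a(w, w)], so [v] is a minimizer exactly
    when all the slopes [a(v, w) - l(w)] vanish, which is the variational equation
    ([energy_line], [energy_minimizerP]).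

    Existence is Riesz representation for the semi-inner product [a], in the form
    of the direct method ([riesz_representation]): the Cauchy-Schwarz inequality
    for the trace product gives [l(kappa)^2 <= |V|_F^2 |S kappa|_F^2 <=
    |V|_F^2 a(kappa, kappa)], so the energy is bounded below; by the parallelogram
    law a fast minimizing sequence is fast Cauchy for [a]; and its limit solves the
    equation.

    The delicate point is that this limit exists in the norm of [a], because the
    entries of [S] are integrals against products of gradients which are only
    assumed to be integrable against every square integrable function. Instead of
    deducing that [S] is bounded, one uses that coercivity makes the sequence fast
    Cauchy in L^2, and that a fast Cauchy sequence of L^2 converges almost
    everywhere and is dominated by one function [w] of L^2 ([L2_fast_cauchy]).
    Since [w] times a sensitivity is integrable, dominated convergence passes to the
    limit in every entry of [S] ([dominated_pairing_cvg]), and also gives convergence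
    in L^2 ([dominated_sqr_dist_cvg0]), hence in [b] by continuity
    ([form_a_complete]).

    Uniqueness is coercivity applied to the difference of two solutions. *)

(** * Minimization of a quadratic energy *)

(** The discriminant criterion, in a form that includes the degenerate case
    [A = 0]. All the Cauchy-Schwarz type inequalities below are instances. *)
Lemma sqr_le_of_quadratic_ge0 (R : realFieldType) (A B C : R) :
  (forall t, 0 <= C + 2 * t * B + t ^+ 2 * A) -> 0 <= A -> B ^+ 2 <= C * A.
Proof.
move=> h; rewrite le_eqVlt => /orP[/eqP A0|A0].
  have [->|B0] := eqVneq B 0; first by rewrite -A0 expr0n mulr0.
  have := h (- (C + 1) / (2 * B)).
  rewrite -A0 mulr0 addr0 (_ : C + _ = -1) ?ler0N1//.
  by field; rewrite B0.
have := h (- B / A).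
rewrite (_ : C + _ + _ = (C * A - B ^+ 2) / A); last by field; rewrite gt_eqF.
by rewrite pmulr_lge0 ?invr_gt0// subr_ge0.
Qed.

Section quadratic_energy.
Context (R : realType) (V : lmodType R) (a : {biscalar V}) (l : {scalar V}).
Hypothesis a_sym : forall v w, a v w = a w v.
Hypothesis a_ge0 : forall v, 0 <= a v v.

Let aDl u v w : a (u + v) w = a u w + a v w. Proof. exact: linearDl. Qed.
Let aDr u v w : a u (v + w) = a u v + a u w. Proof. exact: linearDr. Qed.
Let aZl t v w : a (t *: v) w = t * a v w. Proof. exact: linearZl_LR. Qed.
Let aZr t v w : a v (t *: w) = t * a v w. Proof. exact: linearZr_LR. Qed.
Let aNl v w : a (- v) w = - a v w. Proof. exact: linearNl. Qed.
Let aNr v w : a v (- w) = - a v w. Proof. exact: linearNr. Qed.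

Definition energy (v : V) : R := a v v - 2 * l v.

Lemma energy_line (v w : V) (t : R) :
  energy (v + t *: w) = energy v + 2 * t * (a v w - l w) + t ^+ 2 * a w w.
Proof.
rewrite /energy aDl !aDr !aZl !aZr linearD [l (t *: w)]linearZ /=.
by rewrite (a_sym w v); ring.
Qed.

Lemma energy_minimizerP (v : V) :
  (forall w, energy v <= energy w) <-> (forall w, a v w = l w).
Proof.
split=> [vmin w|vsol w]; last first.
  rewrite -[w](addrNK v) addrC -[w - v]scale1r energy_line vsol subrr.
  by rewrite mulr0 addr0 lerDl expr1n mul1r.
apply/eqP; rewrite -subr_eq0 -sqrf_eq0 eq_le sqr_ge0 andbT.
rewrite -[leRHS](mul0r (a w w)); apply: sqr_le_of_quadratic_ge0 => // t.
by have := vmin (v + t *: w); rewrite energy_line -addrA lerDl add0r.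
Qed.

(** How far [v] is from solving the equation is controlled by how far its energy
    is above any lower bound: the parabola [energy (v + t *: w) - I] is
    nonnegative. *)
Lemma residual_sqr_le (I : R) (v w : V) : (forall z, I <= energy z) ->
  (a v w - l w) ^+ 2 <= (energy v - I) * a w w.
Proof.
move=> Ile; apply: sqr_le_of_quadratic_ge0 => // t.
by have := Ile (v + t *: w); rewrite energy_line; lra.
Qed.

Lemma form_cauchy_schwarz (v w : V) : (a v w) ^+ 2 <= a v v * a w w.
Proof.
apply: sqr_le_of_quadratic_ge0 => // t.
have := a_ge0 (v + t *: w).
by rewrite aDl !aDr !aZl !aZr (a_sym w v); lra.
Qed.

(** Compare with the energy of the midpoint of [v] and [w]; this is what makes
    minimizing sequences Cauchy. *)
Lemma energy_parallelogram (I : R) (v w : V) : (forall z, I <= energy z) ->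
  a (v - w) (v - w) <= 2 * (energy v - I) + 2 * (energy w - I).
Proof.
move=> Ile; have := Ile (2^-1 *: (v + w)).
rewrite /energy aZl aZr !aDl !aDr !aNl !aNr [l (_ *: _)]linearZ linearD /=.
by rewrite (a_sym w v); lra.
Qed.

(** The direct method. The energy is bounded below, so it has a minimizing
    sequence, which can be chosen with steps of at most [4 ^- n] in the norm of
    [a]. Along it the residuals tend to zero by [residual_sqr_le], and by the
    Cauchy-Schwarz inequality they also converge to the residual of the limit. *)
Theorem riesz_representation (K : R) : 0 <= K ->
  (forall v, (l v) ^+ 2 <= K * a v v) ->
  (forall u : nat -> V,
    (forall n, a (u n.+1 - u n) (u n.+1 - u n) <= (16 ^+ n)^-1) ->
    exists v, a (u n - v) (u n - v) @[n --> \oo] --> 0) ->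
  exists v, forall w, a v w = l w.
Proof.
move=> K0 lK complete.
have energy_ge v : - K <= energy v.
  (* 2 l <= a + K because (2 l)^2 <= 4 K a <= (a + K)^2. *)
  have := a_ge0 v; have := lK v; rewrite /energy => la a0.
  rewrite leNgt; apply/negP => lt_l.
  have : (a v v + K) ^+ 2 < (2 * l v) ^+ 2.
    by rewrite ltr_pXn2r// ?nnegrE; lra.
  have := sqr_ge0 (a v v - K); nra.
pose E := [set energy v | v in [set: V]].
have E0 : has_inf E.
  split; first by exists (energy 0), 0.
  by exists (- K) => _ [v _ <-].
pose I := inf E.
have Ile z : I <= energy z by apply: ge_inf; [exact: E0.2|exists z].
(* By the parallelogram law, an excess of 16^-n / 4 gives steps of at most
   16^-n. *)
have min_seq n : exists v, energy v <= I + (16 ^+ n)^-1 / 4.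
  have e0 : 0 < (16 ^+ n)^-1 / 4 :> R by rewrite divr_gt0// invr_gt0 exprn_gt0.
  have [_ [v _ <-] /ltW] := inf_adherent e0 E0.
  by exists v.
have [u uI] := choice min_seq.
have [|v uv] := complete u.
  move=> n; apply: le_trans (energy_parallelogram _ _ Ile) _.
  have := uI n; have := uI n.+1.
  have : (16 ^+ n.+1)^-1 <= (16 ^+ n)^-1 :> R.
    by rewrite lef_pV2 ?posrE ?exprn_gt0// ler_weXn2l// ler1n.
  lra.
exists v => w; apply/eqP; rewrite -subr_eq0 -sqrf_eq0 eq_le sqr_ge0 andbT.
have key n : (a v w - l w) ^+ 2 <=
    2 * ((16 ^+ n)^-1 / 4 + a (u n - v) (u n - v)) * a w w.
  have h1 := residual_sqr_le (u n) w Ile.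
  have h2 := form_cauchy_schwarz (u n - v) w.
  have -> : a v w - l w = (a (u n) w - l w) - a (u n - v) w.
    by rewrite aDl aNl; ring.
  have h3 : (energy (u n) - I) * a w w <= (16 ^+ n)^-1 / 4 * a w w.
    by rewrite ler_wpM2r// lerBlDl.
  have := sqr_ge0 ((a (u n) w - l w) + a (u n - v) w).
  nra.
have lim0 : 2 * ((16 ^+ n)^-1 / 4 + a (u n - v) (u n - v)) * a w w
    @[n --> \oo] --> 2 * (0 / 4 + 0) * a w w.
  apply: cvgM; last exact: cvg_cst.
  apply: cvgM; first exact: cvg_cst.
  apply: cvgD => //; apply: cvgM; last exact: cvg_cst.
  under eq_fun do rewrite -exprVn.
  by apply: cvg_expr; rewrite ger0_norm// ?invr_ge0// invf_lt1 ?ltr1n.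
rewrite -[leRHS](_ : 2 * (0 / 4 + 0) * a w w = 0); last by ring.
by apply: cvgr_to_ge lim0 _; exact: nearW.
Qed.

End quadratic_energy.

(** * Fast Cauchy sequences of square integrable functions *)

Section square_integrable.
Context d (T : measurableType d) (R : realType).
Context (mu : {measure set T -> \bar R}).
Local Notation L2T := (LfunType mu (lee1n 2)).

Lemma sqr_Lnorm2 (f : L2T) :
  fine (Lnorm mu 2%:E (EFin \o f)) ^+ 2 = \int[mu]_x (f x ^+ 2).
Proof.
apply: EFin_inj.
have := @powR_Lnorm _ _ _ mu (EFin \o f) 2 (negbT (pnatr_eq0 R 2)).
rewrite -finite_norm_fine poweR_EFin powR_mulrn ?fine_ge0 ?Lnorm_ge0// => ->.
rewrite /Rintegral fineK; last first.
  by apply: integrable_fin_num => //; exact: Lfun2_integrable_sqr (LfunP f).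
apply: eq_integral => x _ /=; rewrite [X in X%:E = _]powR_mulrn//.
by rewrite real_normK ?num_real.
Qed.

Lemma sqr_integrable_Lfun2 (f : T -> R) : measurable_fun setT f ->
  mu.-integrable setT (fun x => (f x ^+ 2)%:E) -> f \in Lfun mu 2%:E.
Proof.
move=> mf /integrableP[_ foo].
rewrite inE; apply/andP; split; rewrite inE//=.
rewrite /finite_norm unlock; apply: poweR_lty.
apply: le_lt_trans foo; rewrite le_eqVlt; apply/orP; left; apply/eqP.
by apply: eq_integral => x _ /=; rewrite powR_mulrn// normrX.
Qed.

(** The weighted series [H = \sum_n 4^n (u_(n+1) - u_n)^2] is integrable because
    its terms have integrals of at most [C / 4^n]. Where [H] is finite the step
    [n] is at most [sqrt H / 2^n], so the sequence converges and stays within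
    [2 sqrt H] of [u 0]; and [sqrt H] is square integrable. *)
Lemma L2_fast_cauchy (u : nat -> L2T) (C : R) :
  (forall n, \int[mu]_x ((u n.+1 x - u n x) ^+ 2) <= C / 16 ^+ n) ->
  exists v w : L2T,
    {ae mu, forall x, u ^~ x @ \oo --> v x} /\
    {ae mu, forall x, forall n, `|u n x| <= w x}.
Proof.
move=> uC.
have C0 : 0 <= C.
  have := uC 0; rewrite expr0 divr1; apply: le_trans.
  by apply: Rintegral_ge0 => x _; exact: sqr_ge0.
pose f n x := 4 ^+ n * (u n.+1 x - u n x) ^+ 2.
have f0 n x : 0 <= f n x by rewrite mulr_ge0 ?sqr_ge0// exprn_ge0.
have mu_ n : measurable_fun setT (u n : T -> R) by [].
have mf n : measurable_fun setT (f n).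
  apply: measurable_funM => //; apply: measurable_funX.
  exact: measurable_funB.
have dint n : mu.-integrable setT (fun x => ((u n.+1 x - u n x) ^+ 2)%:E).
  exact: Lfun2_integrable_sqr (LfunP (u n.+1 - u n)).
pose H x := (\sum_(n <oo) (f n x)%:E)%E.
have H0 x : (0 <= H x)%E by apply: nneseries_ge0 => n _ _; exact: f0.
have mH : measurable_fun setT H.
  apply: ge0_emeasurable_sum => [n x _ _|n _]; first by rewrite lee_fin.
  exact/measurable_EFinP.
have intH : mu.-integrable setT H.
  apply/integrableP; split=> //.
  under eq_integral do rewrite gee0_abs//.
  rewrite integral_nneseries//; last 2 first.
  - by move=> n; exact/measurable_EFinP.
  - by move=> n x _; rewrite lee_fin.
  apply: (@le_lt_trans _ _ (\sum_(n <oo) (C * (4^-1) ^+ n)%:E)%E).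
    apply: lee_nneseries => [n _ _|n _].
      by apply: integral_ge0 => x _; rewrite lee_fin.
    rewrite /f; under eq_integral do rewrite EFinM.
    rewrite integralZl//.
    rewrite -[X in (_ * X)%E]fineK; last exact: integrable_fin_num.
    rewrite -EFinM lee_fin.
    apply: le_trans (ler_wpM2l _ (uC n)) _; first by rewrite exprn_ge0.
    rewrite le_eqVlt; apply/orP; left; apply/eqP.
    rewrite (_ : 16 = 4 * 4); last by ring.
    rewrite exprMn exprVn; field.
    by rewrite expf_neq0.
  rewrite (_ : (\sum_(n <oo) _)%E = (limn (series (geometric C 4^-1)))%:E).
    exact: ltry.
  rewrite -EFin_lim; last first.
    by apply: is_cvg_geometric_series; rewrite ger0_norm// invf_lt1// ltr1n.
  by congr (limn _); apply/funext => n; rewrite /= sumEFin.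
have Hfin : {ae mu, forall x, H x \is a fin_num}.
  by apply: filterS (integrable_ae measurableT intH) => x; apply.
pose h x := Num.sqrt (fine (H x)).
have step x n : H x \is a fin_num -> `|u n.+1 x - u n x| <= h x * 2^-1 ^+ n.
  move=> Hx.
  have fH : f n x <= fine (H x).
    rewrite -lee_fin fineK//.
    apply: le_trans (nneseries_lim_ge n.+1 _); last first.
      by move=> k _ _; rewrite lee_fin.
    rewrite big_nat_recr//= leeDr//.
    by apply: sume_ge0 => k _; rewrite lee_fin.
  rewrite exprVn ler_pdivlMr ?exprn_gt0// -[leLHS]ger0_norm; last first.
    by rewrite mulr_ge0// exprn_ge0.
  rewrite -sqrtr_sqr /h ler_wsqrtr// (le_trans _ fH)//.
  rewrite /f exprMn real_normK ?num_real// mulrC -exprM mulnC exprM.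
  by rewrite (_ : 2 ^+ 2 = 4) //; ring.
have sum_step x n : H x \is a fin_num -> `|u n x - u 0 x| <= 2 * h x.
  move=> Hx.
  (* The partial sum of the geometric series, kept exact for the induction. *)
  suff : `|u n x - u 0 x| <= 2 * h x * (1 - 2^-1 ^+ n).
    move=> /le_trans; apply; rewrite -[leRHS]mulr1; apply: ler_wpM2l.
      by rewrite mulr_ge0// sqrtr_ge0.
    by rewrite gerBl exprn_ge0// invr_ge0.
  elim: n => [|n IH]; first by rewrite subrr normr0 expr0 subrr mulr0.
  have := step x n Hx; have := ler_normD (u n.+1 x - u n x) (u n x - u 0 x).
  rewrite addrA subrK exprS; nra.
(* Multiplying by the indicator of the set where H is finite makes the sequence
   converge everywhere, so that its limit is measurable. *)
pose E := [set x | H x \is a fin_num].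
have mE : measurable E.
  by rewrite -[E]setTI; exact: emeasurable_fin_num.
pose g n x := u n x * \1_E x.
have mg n : measurable_fun setT (g n) by apply: measurable_funM.
have g_cvg x : cvgn (g ^~ x).
  have [Hx|/negP Hx] := boolP (H x \is a fin_num); last first.
    rewrite (_ : g ^~ x = cst 0); first exact: is_cvg_cst.
    by apply/funext => n; rewrite /g indicE memNset ?mulr0.
  have -> : g ^~ x = u ^~ x.
    by apply/funext => n; rewrite /g indicE mem_set ?mulr1.
  rewrite (_ : u ^~ x = fun n => u 0 x + series (telescope (u ^~ x)) n); last first.
    by apply/funext => n; rewrite -eq_sum_telescope.
  apply: is_cvgD; first exact: is_cvg_cst.
  apply: normed_cvg.
  apply: (@series_le_cvg _ _ (geometric (h x) 2^-1)) => [n|n|n|].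
  - exact: normr_ge0.
  - by rewrite /= mulr_ge0 ?sqrtr_ge0// exprn_ge0// invr_ge0.
  - exact: step.
  - by apply: is_cvg_geometric_series; rewrite ger0_norm// invf_lt1// ltr1n.
pose v x := limn (g ^~ x).
have mv : measurable_fun setT v.
  by apply: (measurable_fun_cvg mg) => x _; exact: g_cvg.
pose w x := `|u 0 x| + 2 * h x.
have mh : measurable_fun setT h.
  apply: (@measurableT_comp _ _ _ _ _ _ (@Num.sqrt R)).
    exact: continuous_measurable_fun (@sqrt_continuous R).
  exact: measurableT_comp.
have mw : measurable_fun setT w.
  apply: measurable_funD; first exact: measurableT_comp.
  exact: measurable_funM.
have iw : mu.-integrable setT (fun x => (w x ^+ 2)%:E).
  have i1 : mu.-integrable setT
      (fun x => (2%:E * (u 0 x ^+ 2)%:E + 8%:E * H x)%E).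
    apply: integrableD => //; apply: integrableZl => //.
    exact: Lfun2_integrable_sqr (LfunP (u 0)).
  apply: (le_integrable measurableT) i1.
    by apply/measurable_EFinP; exact: measurable_funX.
  move=> x _; rewrite !gee0_abs; last 2 first.
  - by rewrite adde_ge0// mule_ge0// lee_fin sqr_ge0.
  - by rewrite lee_fin sqr_ge0.
  have [Hx|] := boolP (H x \is a fin_num); last first.
    rewrite ge0_fin_numE// -leNgt leye_eq => /eqP ->.
    by rewrite gt0_muley// addey// leey.
  rewrite -(fineK Hx) -!EFinM -EFinD lee_fin /w.
  have : h x ^+ 2 = fine (H x) by rewrite sqr_sqrtr// fine_ge0.
  (* (p + q)^2 <= 2 p^2 + 2 q^2 with p = |u 0 x| and q = 2 h x. *)
  have := sqr_ge0 (`|u 0 x| - 2 * h x).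
  by rewrite -[u 0 x ^+ 2]real_normK ?num_real//; nra.
have wL2 : w \in Lfun mu 2%:E by exact: sqr_integrable_Lfun2.
have w0 x : 0 <= w x by rewrite addr_ge0// mulr_ge0// sqrtr_ge0.
have ug x n : H x \is a fin_num -> g n x = u n x.
  by move=> Hx; rewrite /g indicE mem_set ?mulr1.
have uw x n : H x \is a fin_num -> `|u n x| <= w x.
  move=> Hx; have := sum_step x n Hx; have := ler_normD (u n x - u 0 x) (u 0 x).
  by rewrite subrK /w; lra.
have uv x : H x \is a fin_num -> u ^~ x @ \oo --> v x.
  move=> Hx; have := g_cvg x; rewrite -/(v x) (_ : g ^~ x = u ^~ x)//.
  by apply/funext => n; rewrite ug.
have vL2 : v \in Lfun mu 2%:E.
  apply: sqr_integrable_Lfun2 => //.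
  apply: (le_integrable measurableT _ _ iw).
    by apply/measurable_EFinP; exact: measurable_funX.
  move=> x _; rewrite !gee0_abs ?lee_fin ?sqr_ge0// -[v x ^+ 2]real_normK ?num_real//.
  rewrite ler_sqr ?nnegrE// ?w0//.
  apply: (cvgr_to_le (cvg_norm (g_cvg x))); apply: nearW => n.
  have [Hx|/negP Hx] := boolP (H x \is a fin_num).
    by rewrite ug// uw.
  by rewrite /g indicE memNset// mulr0 normr0 w0.
exists (Lfun_Sub (lee1n 2) vL2), (Lfun_Sub (lee1n 2) wL2); split.
  by apply: filterS Hfin => x Hx /=; exact: uv.
by apply: filterS Hfin => x Hx n; exact: uw.
Qed.

Section dominated_sequence.
Variables (u : nat -> L2T) (v w : L2T).
Hypothesis uv : {ae mu, forall x, u ^~ x @ \oo --> v x}.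
Hypothesis uw : {ae mu, forall x, forall n, `|u n x| <= w x}.

(** The dominating function is [|w s|], which is integrable by hypothesis since [w]
    is in L^2. *)
Lemma dominated_pairing_cvg (s : T -> R) :
  (forall k : L2T, mu.-integrable setT (fun x => (k x * s x)%:E)) ->
  \int[mu]_x (u n x * s x) @[n --> \oo] --> \int[mu]_x (v x * s x).
Proof.
move=> si; apply: fine_cvg.
have [|||||_ _] := @dominated_convergence _ _ _ mu setT measurableT
  (fun n x => (u n x * s x)%:E) (fun x => (v x * s x)%:E)
  (fun x => `|(w x * s x)%:E|%E).
- by move=> n; exact: measurable_int (si (u n)).
- exact: measurable_int (si v).
- apply: filterS uv => x uvx _; apply: cvg_EFin; first exact: nearW.
  by apply: cvgM => //; exact: cvg_cst.
- exact: integrable_abse (si w).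
- apply: filterS uw => x uwx n _; rewrite !abse_EFin lee_fin !normrM.
  by rewrite ler_wpM2r// (le_trans (uwx n))// ler_norm.
rewrite fineK; last exact: integrable_fin_num (si v).
by [].
Qed.

Lemma dominated_sqr_dist_cvg0 :
  \int[mu]_x ((u n x - v x) ^+ 2) @[n --> \oo] --> 0.
Proof.
have [|||||_ _] := @dominated_convergence _ _ _ mu setT measurableT
  (fun n x => ((u n x - v x) ^+ 2)%:E) (cst 0%E)
  (fun x => (4%:E * (w x ^+ 2)%:E)%E).
- move=> n; apply: measurable_int (Lfun2_integrable_sqr (LfunP (u n - v))).
- exact: measurable_cst.
- apply: filterS uv => x uvx _; apply: cvg_EFin; first exact: nearW.
  rewrite [X in _ --> X](_ : 0 = (v x - v x) * (v x - v x)); last first.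
    by rewrite subrr mul0r.
  by apply: cvgM; apply: cvgB => //; exact: cvg_cst.
- by apply: integrableZl => //; exact: Lfun2_integrable_sqr (LfunP w).
- apply: filterS2 uv uw => x uvx uwx n _; rewrite abse_EFin -EFinM lee_fin.
  have vw : `|v x| <= w x.
    by apply: (cvgr_to_le (cvg_norm uvx)); exact: nearW.
  rewrite normrX (_ : 4 * w x ^+ 2 = (2 * w x) ^+ 2); last by ring.
  have uvw : `|u n x - v x| <= 2 * w x.
    by have := uwx n; have := ler_normB (u n x) (v x); lra.
  by rewrite ler_sqr// nnegrE (le_trans _ uvw).
rewrite integral0 => h; apply: fine_cvg; exact: h.
Qed.

End dominated_sequence.

End square_integrable.

(** * The Frobenius inner product *)

Section frobenius_product.
Context (R : realType) (m : nat).
Implicit Types A B : 'M[R]_m.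

Lemma frobenius_productE A B : \tr (A^T *m B) = \sum_i \sum_j A j i * B j i.
Proof.
by apply: eq_bigr => i _; rewrite mxE; apply: eq_bigr => j _; rewrite mxE.
Qed.

Lemma frobenius_productC A B : \tr (A^T *m B) = \tr (B^T *m A).
Proof. by rewrite -mxtrace_tr trmx_mul trmxK. Qed.

Lemma frob2_ge0 A : 0 <= frob2 A.
Proof.
rewrite /frob2 frobenius_productE; apply: sumr_ge0 => i _.
by apply: sumr_ge0 => j _; rewrite -expr2 sqr_ge0.
Qed.

Lemma frob2D A B t :
  frob2 (A + t *: B) = frob2 A + 2 * t * \tr (A^T *m B) + t ^+ 2 * frob2 B.
Proof.
have trAB : (A + t *: B)^T = A^T + t *: B^T.
  by apply/matrixP => i j; rewrite !mxE.
rewrite /frob2 trAB mulmxDl !mulmxDr -!scalemxAl -!scalemxAr.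
by rewrite !mxtraceD !mxtraceZ (frobenius_productC B A); ring.
Qed.

Lemma frobenius_cauchy_schwarz A B :
  (\tr (A^T *m B)) ^+ 2 <= frob2 A * frob2 B.
Proof.
apply: sqr_le_of_quadratic_ge0; last exact: frob2_ge0.
by move=> t; rewrite -frob2D frob2_ge0.
Qed.

Lemma frob2_cvg0 (A : nat -> 'M[R]_m) :
  (forall i j, A n i j @[n --> \oo] --> 0) -> frob2 (A n) @[n --> \oo] --> 0.
Proof.
move=> A0.
have -> : (fun n => frob2 (A n)) = fun n => \sum_i \sum_j A n j i * A n j i.
  by apply/funext => n; rewrite /frob2 frobenius_productE.
have sum_cvg0 (F : 'I_m -> nat -> R) : (forall i, F i n @[n --> \oo] --> 0) ->
    \sum_i F i n @[n --> \oo] --> 0.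
  move=> F0.
  rewrite -[X in _ --> X](@big1 _ _ +%R _ (index_enum 'I_m) xpredT (cst 0))//.
  apply: (@cvg_big R 'I_m +%R 0 xpredT _ nat \oo (index_enum _) F (cst 0)) => //.
  exact: add_continuous.
apply: (sum_cvg0 (fun i n => \sum_j A n j i * A n j i)) => i.
apply: (sum_cvg0 (fun j n => A n j i * A n j i)) => j.
by rewrite -[X in _ --> X](mulr0 0); exact: cvgM.
Qed.

End frobenius_product.

(** * The regularized problem *)

Section measurement.
Context (R : realType) (d : nat) (Omega : set 'rV[R]_d).
Context (m : nat) (g : 'I_m -> L2bd Omega) (hS : S_well_defined g).

Lemma S_mx_linear (t : R) (k h : L2 Omega) :
  S_mx g (t *: k + h) = t *: S_mx g k + S_mx g h.
Proof.
apply/matrixP => i j; rewrite !mxE.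
rewrite -RintegralZl//; last exact: hS.
rewrite -RintegralD//; last 2 first.
- have := integrableZl measurableT t (hS k i j).
  by apply: eq_integrable.
- exact: hS.
by apply: eq_Rintegral => x _; rewrite mulrA -mulrDl.
Qed.


Section regularization.
Context (sigma : 'rV[R]_d -> R) (alpha : R) (alpha_gt0 : 0 < alpha).
Context (b : {biscalar (L2 Omega)}).
Local Notation a := (form_a g alpha b).
Local Notation l := (form_l g sigma).
Local Notation L2 := (L2 Omega).

Lemma form_l_scalar : scalar l.
Proof.
move=> t k h.
by rewrite /form_l S_mx_linear mulmxDr -scalemxAr mxtraceD mxtraceZ.
Qed.

Lemma form_a_bilinear : bilinear_for *%R *%R a.
Proof.
split=> [h t k1 k2|k t h1 h2]; rewrite /form_a S_mx_linear.
  rewrite (linearPl b) /= frobenius_productC mulmxDr -scalemxAr mxtraceD mxtraceZ.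
  by rewrite !(frobenius_productC (S_mx g h)); ring.
by rewrite (linearPr b) /= mulmxDr -scalemxAr mxtraceD mxtraceZ; ring.
Qed.

Definition biscalar_a : {biscalar L2} :=
  HB.pack a (bilinear_isBilinear.Build R L2 L2 R *%R *%R a form_a_bilinear).

Definition scalar_l : {scalar L2} :=
  HB.pack l (GRing.isLinear.Build R L2 R *%R l form_l_scalar).

(** This identity reduces the minimization problem to that of the energy. *)
Lemma objectiveE (k : L2) :
  objective g alpha b sigma k =
  frob2 (V_mx g sigma) + energy biscalar_a scalar_l k.
Proof.
rewrite /objective -scaleN1r frob2D /energy /= /form_a /form_l -/(frob2 _).
by ring.
Qed.

Hypothesis b_sym : forall k h, b k h = b h k.

Lemma form_a_sym (k h : L2) : a k h = a h k.
Proof. by rewrite /form_a frobenius_productC b_sym. Qed.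

Hypothesis b_coercive : coercive_form b.

Lemma form_a_coercive : exists2 c : R, 0 < c &
  forall k : L2, c * \int[volume Omega]_x (k x ^+ 2) <= a k k.
Proof.
have [c c0 bc] := b_coercive; exists (alpha * c); first exact: mulr_gt0.
move=> k; rewrite -sqr_Lnorm2 -mulrA; apply: le_trans (_ : alpha * b k k <= _).
  by rewrite ler_pM2l//; exact: bc.
by rewrite lerDr; exact: frob2_ge0.
Qed.

Lemma form_a_ge0 (k : L2) : 0 <= a k k.
Proof.
have [c c0 ac] := form_a_coercive; apply: le_trans (ac k).
rewrite mulr_ge0 ?(ltW c0)//; apply: Rintegral_ge0 => x _; exact: sqr_ge0.
Qed.

Lemma minimizer_variationalP (k : L2) :
  is_minimizer (objective g alpha b sigma) k <->
  is_variational_solution g alpha b sigma k.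
Proof.
rewrite /is_variational_solution.
rewrite -(@energy_minimizerP _ _ biscalar_a scalar_l form_a_sym form_a_ge0).
by split=> kmin h; have := kmin h; rewrite !objectiveE lerD2l.
Qed.

(** [l k] is the Frobenius product of the data with [S k], and the squared norm of
    [S k] is one of the two nonnegative terms of [a k k]. *)
Lemma form_l_bounded (k : L2) :
  l k ^+ 2 <= frob2 (V_mx g sigma) * a k k.
Proof.
apply: le_trans (frobenius_cauchy_schwarz _ _) _.
rewrite ler_wpM2l ?frob2_ge0// /form_a lerDl mulr_ge0 ?(ltW alpha_gt0)//.
have [c c0 bc] := b_coercive; apply: le_trans (bc k).
by rewrite mulr_ge0 ?sqr_ge0// ltW.
Qed.

Hypothesis b_continuous : continuous_form b.

(** Coercivity turns the hypothesis into a fast Cauchy condition in L^2. The limit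
    is then compatible with [S], entry by entry, thanks to the common dominating
    function, and with [b] thanks to its continuity. *)
Lemma form_a_complete (u : nat -> L2) :
  (forall n, a (u n.+1 - u n) (u n.+1 - u n) <= (16 ^+ n)^-1) ->
  exists v, a (u n - v) (u n - v) @[n --> \oo] --> 0.
Proof.
move=> ua; have [c c0 ac] := form_a_coercive.
have [|v [w [uv uw]]] := @L2_fast_cauchy _ _ _ (volume Omega) u c^-1.
  move=> n; rewrite ler_pdivlMl//; exact: le_trans (ac _) (ua n).
exists v.
have S_cvg0 : frob2 (S_mx g (u n - v)) @[n --> \oo] --> 0.
  apply: frob2_cvg0 => i j.
  have -> : (fun n => S_mx g (u n - v) i j) =
      fun n => S_mx g (u n) i j - S_mx g v i j.
    apply/funext => n; rewrite -[u n - v]addrC -scaleN1r S_mx_linear.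
    by rewrite !mxE; ring.
  have S_cvg : S_mx g (u n) i j @[n --> \oo] --> S_mx g v i j.
    rewrite mxE; under eq_fun do rewrite mxE.
    by apply: (dominated_pairing_cvg uv uw) => k; exact: hS.
  rewrite -[X in _ --> X](subrr (S_mx g v i j)).
  by apply: cvgB => //; exact: cvg_cst.
have [C bC] := b_continuous.
have b_cvg0 : b (u n - v) (u n - v) @[n --> \oo] --> 0.
  have bound_cvg0 :
      C * \int[volume Omega]_x ((u n x - v x) ^+ 2) @[n --> \oo] --> 0.
    rewrite -[X in _ --> X](mulr0 C).
    by apply: cvgM; [exact: cvg_cst|exact: (dominated_sqr_dist_cvg0 uv uw)].
  apply/norm_cvg0P; apply: squeeze_cvgr (cvg_cst 0) bound_cvg0.
  apply: nearW => n; rewrite normr_ge0 /=.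
  apply: le_trans (bC _ _) _; rewrite -mulrA -expr2.
  by rewrite [L2norm _ ^+ 2]sqr_Lnorm2.
rewrite -[X in _ --> X](_ : 0 + alpha * 0 = 0); last by rewrite mulr0 addr0.
by apply: cvgD => //; apply: cvgM => //; exact: cvg_cst.
Qed.

Lemma variational_solution_exists :
  exists k : L2, is_variational_solution g alpha b sigma k.
Proof.
apply: (@riesz_representation _ _ biscalar_a scalar_l form_a_sym form_a_ge0
  (frob2 (V_mx g sigma))).
- exact: frob2_ge0.
- exact: form_l_bounded.
- exact: form_a_complete.
Qed.

Lemma variational_solution_unique (k k' : L2) :
  is_variational_solution g alpha b sigma k ->
  is_variational_solution g alpha b sigma k' ->
  k' = k %[ae volume Omega].
Proof.
move=> kl k'l; have [c c0 ac] := form_a_coercive.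
have a0 : a (k' - k) (k' - k) = 0.
  have := linearBl biscalar_a (k' - k) k' k; rewrite /= => ->.
  by rewrite kl k'l subrr.
have n0 : fine (Lnorm (volume Omega) 2%:E (EFin \o (k' - k))) = 0.
  apply/eqP; rewrite -sqrf_eq0 sqr_Lnorm2 eq_le.
  apply/andP; split; last by apply: Rintegral_ge0 => x _; exact: sqr_ge0.
  by rewrite -(pmulr_rle0 _ c0) (le_trans (ac _))// a0.
apply: filterS (fine_Lnormr_eq0 n0) => x h _.
by apply/eqP; rewrite -subr_eq0; apply/eqP; exact: h.
Qed.

End regularization.

End measurement.


Theorem theorem2p1 (R : realType) (d : nat) (hd : (2 <= d)%N)
    (Omega : set 'rV[R]_d) (hOmega : smooth_domain Omega)
    (m : nat) (g : 'I_m -> L2bd Omega) (hg : forall i, zero_mean (g i))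
    (hS : S_well_defined g)
    (sigma : 'rV[R]_d -> R) (hsigma : Linfty_plus Omega sigma)
    (alpha : R) (halpha : 0 < alpha)
    (b : {biscalar (L2 Omega)})
    (bsym : forall kappa eta, b kappa eta = b eta kappa)
    (bcont : continuous_form b) (bcoer : coercive_form b) :
  [/\ bilinear_for *%R *%R (form_a g alpha b),
      scalar (form_l g sigma),
      forall kappa : L2 Omega,
        is_minimizer (objective g alpha b sigma) kappa <->
        is_variational_solution g alpha b sigma kappa &
      exists2 kappa : L2 Omega,
        is_variational_solution g alpha b sigma kappa &
        forall kappa' : L2 Omega,
          is_variational_solution g alpha b sigma kappa' ->
          kappa' = kappa %[ae volume Omega]].
Proof.
split.
- exact: form_a_bilinear.
- exact: form_l_scalar.
- exact: minimizer_variationalP.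
- have [k ksol] :=
    variational_solution_exists hS sigma halpha bsym bcoer bcont.
  exists k => // k'; exact: variational_solution_unique.
Qed.
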